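(* If $\sigma$ and $\rho$ are non-crossing partitions and $\sigma$ is connected, then $\sigma[\rho]$ and $\rho[\sigma]$ are cc-equivalent.
   Context: Set partitions are written in canonical sequential form (restricted growth words). A partition is non-crossing if it avoids the pattern $1212$ (pattern containment = having a subsequence order-isomorphic to the pattern). For partitions $\alpha,\beta$, $\alpha[\beta]$ is the concatenation of $\alpha$ with $\beta+r$, $r$ the number of blocks of $\alpha$. A partition $\pi$ is connected if it cannot be written as $\alpha[\beta]$ with $\alpha,\beta$ nonempty; every partition is uniquely $\pi=\sigma_1[\sigma_2]\cdots[\sigma_m]$ with nonempty connected $\sigma_i$, its components. Two non-crossing patterns $\sigma,\tau$ are cc-equivalent if there is a bijection from the set of partitions avoiding both $1212$ and $\sigma$ to the set of partitions avoiding both $1212$ and $\tau$ that preserves size and number of components. *)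

(* Defs.v *)
From mathcomp Require Import all_boot.
Set Implicit Arguments. Unset Strict Implicit. Unset Printing Implicit Defensive.

(* Set partitions in canonical sequential form (restricted growth words),
   blocks numbered 1,2,3,...: first letter is 1 and each letter is at most
   1 + the maximum of the previous letters. The empty word is the empty
   partition. *)
Fixpoint rgf_aux (m : nat) (s : seq nat) : bool :=
  if s is x :: s' then (0 < x <= m.+1) && rgf_aux (maxn m x) s' else true.
Definition is_partition (s : seq nat) : bool := rgf_aux 0 s.

Definition nblocks (s : seq nat) : nat := foldr maxn 0 s.

Definition order_iso (t p : seq nat) : bool :=
  (size t == size p) &&
  all (fun i => all (fun j => (nth 0 t i < nth 0 t j) == (nth 0 p i < nth 0 p j))
                    (iota 0 (size p))) (iota 0 (size p)).

Definition contains (s p : seq nat) : Prop :=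
  exists t, subseq t s /\ order_iso t p.

Definition noncrossing (s : seq nat) : Prop := ~ contains s [:: 1; 2; 1; 2].

Definition pjoin (a b : seq nat) : seq nat := a ++ map (addn (nblocks a)) b.

Definition connected (s : seq nat) : Prop :=
  is_partition s /\ s <> [::] /\
  ~ (exists a b, is_partition a /\ is_partition b /\ a <> [::] /\ b <> [::]
                 /\ s = pjoin a b).

(* s has m components: s = sigma_1[sigma_2]...[sigma_m] with all sigma_i
   (nonempty) connected.  (Such a decomposition is unique.) *)
Definition has_ncomp (s : seq nat) (m : nat) : Prop :=
  exists cs : seq (seq nat),
    size cs = m /\ (forall c, c \in cs -> connected c) /\ s = foldl pjoin [::] cs.

Definition NCAv (sigma : seq nat) : Type :=
  { s : seq nat | is_partition s /\ noncrossing s /\ ~ contains s sigma }.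

Definition cc_equiv (sigma tau : seq nat) : Prop :=
  exists f : NCAv sigma -> NCAv tau,
    bijective f /\
    forall x, size (proj1_sig (f x)) = size (proj1_sig x) /\
              forall m, has_ncomp (proj1_sig x) m <-> has_ncomp (proj1_sig (f x)) m.

(* Main.v *)
Require Import Defs.
From mathcomp Require Import all_boot.
From mathcomp Require Import zify.
From Stdlib Require Import ClassicalEpsilon ProofIrrelevance.
Set Implicit Arguments. Unset Strict Implicit. Unset Printing Implicit Defensive.

(* Choose a position in a non-crossing partition and let [a] be its letter. The
   letters before the first [a] form a partition [A], those from the first [a] up
   to the position a connected partition [r], and the later letters greater than
   [a] a partition [B]. The remaining letters are reused letters of the components
   of [A[r]], placed in the gaps between the components of [B], weakly decreasing
   from left to right: a multichain [M] in a product of two chains. Transposing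
   [M] exchanges the roles of [A] and [B] and keeps size and number of components.

   A partition containing [sigma] has a unique such splitting in which [A] avoids
   [sigma] and [r] is minimal, i.e. contains [sigma] only together with its last
   letter; for it, avoiding [sigma[rho]] means that [B] avoids [rho]. It also has a unique one in which [B]
   avoids [sigma] and [r] is minimal; for it, avoiding [rho[sigma]] means that [A]
   avoids [rho]. Hence the transposition maps the avoiders of [sigma[rho]] that
   contain [sigma] onto those of [rho[sigma]]; the partitions avoiding [sigma] are
   left fixed. *)

(** * Block counts and restricted growth words *)

Lemma nblocks_cat u v : nblocks (u ++ v) = maxn (nblocks u) (nblocks v).
Proof. by elim: u => [|x u IH] /=; rewrite ?max0n // IH maxnA. Qed.

Lemma nblocks_rcons u x : nblocks (rcons u x) = maxn (nblocks u) x.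
Proof. by rewrite -cats1 nblocks_cat /= maxn0. Qed.

Lemma leq_nblocks u (x : nat) : x \in u -> x <= nblocks u.
Proof.
elim: u => // y u IH; rewrite in_cons leq_max => /orP [/eqP ->|/IH ->] //=.
  by rewrite leqnn.
by rewrite orbT.
Qed.

Lemma rgf_aux_cat m u v :
  rgf_aux m (u ++ v) = rgf_aux m u && rgf_aux (maxn m (nblocks u)) v.
Proof.
elim: u m => [|x u IH] m /=; first by rewrite maxn0.
by rewrite IH andbA maxnA.
Qed.

Lemma is_partition_rcons u x :
  is_partition (rcons u x) = is_partition u && (0 < x <= (nblocks u).+1).
Proof. by rewrite /is_partition -cats1 rgf_aux_cat /= andbT max0n. Qed.

Lemma is_partition_prefix u v : is_partition (u ++ v) -> is_partition u.
Proof. by rewrite /is_partition rgf_aux_cat => /andP []. Qed.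

Lemma partition_gt0 u (x : nat) : is_partition u -> x \in u -> 0 < x.
Proof.
elim/last_ind: u => // u y IH; rewrite is_partition_rcons => /andP [pu /andP [y0 _]].
by rewrite mem_rcons in_cons => /orP [/eqP ->|/(IH pu)].
Qed.

Lemma partition_mem u (x : nat) : is_partition u -> 0 < x <= nblocks u -> x \in u.
Proof.
elim/last_ind: u => [|u y IH]; first by rewrite /=; lia.
rewrite is_partition_rcons nblocks_rcons mem_rcons in_cons => /andP [pu yu] xy.
by case: eqP => //= ne; apply: IH => //; lia.
Qed.

(** When [y] first appears, restricted growth has already produced every smaller letter. This
    supplies the first half of the crossings exhibited below. *)
Lemma partition_subseq2 u (x y : nat) :
  is_partition u -> y \in u -> 0 < x < y -> subseq [:: x; y] u.
Proof.
elim/last_ind: u => // u z IH.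
rewrite is_partition_rcons mem_rcons in_cons => /andP [pu zu] yu xy.
case: (boolP (y \in u)) => yu'.
  exact: subseq_trans (IH pu yu' xy) (subseq_rcons u z).
have eyz : y = z by move: yu; rewrite (negbTE yu') orbF => /eqP.
subst z; rewrite -[[:: x; y]]/(rcons [:: x] y) -!cats1; apply: cat_subseq => //.
by rewrite sub1seq; apply: partition_mem => //; lia.
Qed.

(** * Level words *)

(* A non-crossing partition is encoded by replacing every letter by its rank
   among the blocks that can still be reused without creating a crossing; a new
   block gets the next rank, and using a block closes all those above it. The
   last level is then the number of components. *)
Definition level_path (k : nat) (w : seq nat) : bool := path (fun k x => 0 < x <= k.+1) k w.
Definition level_word (w : seq nat) : bool := level_path 0 w.

Definition decode_step (us : seq nat * seq nat) (h : nat) :=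
  let st := take h (rcons us.2 (nblocks us.1).+1) in (rcons us.1 (last 0 st), st).

Definition run := foldl decode_step.
Definition decode (w : seq nat) : seq nat := (run ([::], [::]) w).1.
Definition open_blocks (w : seq nat) : seq nat := (run ([::], [::]) w).2.

Lemma level_word_rcons w x : level_word (rcons w x) = level_word w && (0 < x <= (last 0 w).+1).
Proof. by rewrite /level_word /level_path rcons_path. Qed.

Lemma run_rcons us w x : run us (rcons w x) = decode_step (run us w) x.
Proof. exact: foldl_rcons. Qed.

Lemma size_dec w : size (decode w) = size w.
Proof.
by elim/last_ind: w => // w x IH; rewrite /decode run_rcons /= !size_rcons -/(decode w) IH.
Qed.

Lemma decode_stepS us k :
  k <= size us.2 ->
  decode_step us k.+1 = let z := nth 0 (rcons us.2 (nblocks us.1).+1) k in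
                        (rcons us.1 z, rcons (take k us.2) z).
Proof.
move=> kn; have -> : take k us.2 = take k (rcons us.2 (nblocks us.1).+1).
  by rewrite -cats1 takel_cat.
by rewrite /decode_step (take_nth 0) ?size_rcons // last_rcons.
Qed.

Lemma decode_rcons w k (z := nth 0 (rcons (open_blocks w) (nblocks (decode w)).+1) k) :
  k <= size (open_blocks w) ->
  decode (rcons w k.+1) = rcons (decode w) z
  /\ open_blocks (rcons w k.+1) = rcons (take k (open_blocks w)) z.
Proof. by move=> kn; rewrite /decode /open_blocks run_rcons decode_stepS. Qed.

(* The stack consists of the letters that a non-crossing word may still reuse. *)
Record decode_inv (w : seq nat) : Prop := DecInv {
  inv_part : is_partition (decode w);
  inv_size : size (open_blocks w) = last 0 w;
  inv_sort : sorted ltn (open_blocks w);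
  inv_sub : subseq (open_blocks w) (decode w);
  inv_live : forall b c, b \in open_blocks w -> subseq [:: b; c] (decode w) -> b <= c;
  inv_dead : forall b, b \in decode w -> b \notin open_blocks w ->
               exists2 c, 0 < c < b & subseq [:: c; b; c] (decode w) }.

Lemma subseq_rcons2 (u v : seq nat) x : subseq u v -> subseq (rcons u x) (rcons v x).
Proof. by move=> uv; rewrite -!cats1; apply: cat_subseq. Qed.

Lemma subseq_rconsP (t u : seq nat) x :
  subseq t (rcons u x) -> subseq t u \/ exists2 t', t = rcons t' x & subseq t' u.
Proof.
rewrite -subseq_rev rev_rcons.
case/lastP: t => [|t y]; first by left; apply: sub0seq.
rewrite rev_rcons /=; case: eqP => [->|_]; rewrite ?subseq_rev => s; last first.
  by left; rewrite -subseq_rev rev_rcons.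
by right; exists t.
Qed.

Lemma decode_invP w : level_word w -> decode_inv w.
Proof.
elim/last_ind: w => [_|w h IH]; first by split.
rewrite level_word_rcons => /andP [/IH [pw sw so sub live dead]].
case: h => // k; rewrite ltnS /= => kw; have kst : k <= size (open_blocks w) by rewrite sw.
have /= [] := decode_rcons kst.
set n := nblocks (decode w); set z := nth 0 _ _ => ed es.
have stn b : b \in open_blocks w -> 0 < b <= n.
  by move=> bs; rewrite (partition_gt0 pw) ?leq_nblocks //; apply: (mem_subseq sub).
have soR : sorted ltn (rcons (open_blocks w) n.+1).
  case E: (open_blocks w) => [|y s] //; rewrite /= rcons_path.
  move: so; rewrite E /= => ->; rewrite /= ltnS.
  have lst : last y s \in open_blocks w by rewrite E mem_last.
  by case/andP: (stn _ lst).
have zR : z \in rcons (open_blocks w) n.+1 by rewrite mem_nth // size_rcons.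
have zn : 0 < z <= n.+1.
  by move: zR; rewrite mem_rcons in_cons => /orP [/eqP ->|/stn]; lia.
have subR : subseq (rcons (take k (open_blocks w)) z) (rcons (decode w) z).
  by apply: subseq_rcons2; apply: subseq_trans (take_subseq _ _) sub.
have etk : rcons (take k (open_blocks w)) z = take k.+1 (rcons (open_blocks w) n.+1).
  by rewrite (take_nth 0) ?size_rcons //; congr rcons; rewrite -cats1 takel_cat.
have ltz b : b \in take k (open_blocks w) -> b < z.
  move=> /(nthP 0) [i]; rewrite size_takel // => ik <-; rewrite nth_take //.
  have -> : nth 0 (open_blocks w) i = nth 0 (rcons (open_blocks w) n.+1) i.
    by rewrite nth_rcons (leq_trans ik).
  apply: (sorted_ltn_nth ltn_trans 0 soR) => //; rewrite inE size_rcons; lia.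
split; rewrite ?ed ?es.
- by rewrite is_partition_rcons pw zn.
- by rewrite size_rcons size_takel // last_rcons.
- by rewrite etk; apply: (subseq_sorted ltn_trans (take_subseq _ _)).
- by [].
- move=> b c; rewrite mem_rcons in_cons => bz /subseq_rconsP [s|[t']].
    case/orP: bz => [/eqP bz|/mem_take bs]; last by apply: live.
    apply: (live) (s); move: zR; rewrite mem_rcons in_cons -bz => /orP [/eqP|//].
    by move/mem_subseq: s => /(_ b); rewrite inE eqxx => /(_ isT) /leq_nblocks; rewrite -/n; lia.
  case: t' => [|b' [|? []]] //= [_ ->] _.
  by case/orP: bz => [/eqP ->|/ltz /ltnW].
- move=> b; rewrite !mem_rcons !in_cons; case: eqP => //= bz bd bs.
  case: (boolP (b \in open_blocks w)) => [bst|/(dead _ bd) [c cb s]]; last first.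
    by exists c => //; apply: subseq_trans s (subseq_rcons _ _).
  (* A block closed by this step lies above position [k] of the stack, so [z] is an old block below
     [b]; [z; b] has occurred, and the new [z] completes [z; b; z]. *)
  have [zs zb] : z \in open_blocks w /\ z < b.
    move/(nthP 0): bst => [i isz ei].
    have ki : k < i.
      rewrite ltnNge; apply/negP => ik; case: (ltngtP i k) ik => // ik _.
        by case/negP: bs; rewrite -ei -(nth_take 0 ik) mem_nth // size_takel.
      by apply: bz; rewrite -ei ik /z nth_rcons -ik isz.
    have kst' : k < size (open_blocks w) by apply: ltn_trans isz.
    have -> : z = nth 0 (open_blocks w) k by rewrite /z nth_rcons kst'.
    split; first exact: mem_nth.
    by rewrite -ei; apply: (sorted_ltn_nth ltn_trans 0 so).
  exists z; first by rewrite zb andbT; case/andP: zn.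
  rewrite -[[:: z; b; z]]/(rcons [:: z; b] z); apply: subseq_rcons2.
  by apply: partition_subseq2 => //; lia.
Qed.

(** * Level words encode exactly the non-crossing partitions *)

Definition crossing (s : seq nat) := exists a b, a < b /\ subseq [:: a; b; a; b] s.

Lemma noncrossingP s : noncrossing s <-> ~ crossing s.
Proof.
split=> nc; move=> [].
  move=> a [b [ab sub]]; apply: nc; exists [:: a; b; a; b]; split=> //.
  have ba : (b < a) = false by lia.
  by rewrite /order_iso /= !ltnn ab ba.
move=> t [sub]; case: t sub => [|a [|b [|c [|d []]]]] // sub.
rewrite /order_iso /= !ltnn /= => H; apply: nc; exists a, b.
have ? : a = c by lia. have ? : b = d by lia. subst c d.
by split=> //; lia.
Qed.

(** An added [b] completing [a; b; a; b] would come from the stack, but the smaller [a] has occurred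
    after a [b], contrary to [inv_live]. *)
Lemma decode_noncrossing w : level_word w -> ~ crossing (decode w).
Proof.
elim/last_ind: w => [_ [a [b [_]]] //|w h IH].
rewrite level_word_rcons => /andP [lw]; case: h => // k; rewrite ltnS /= => kw.
have [pw sw so sub live _] := decode_invP lw.
have kst : k <= size (open_blocks w) by rewrite sw.
have [-> _] := decode_rcons kst.
set z := nth 0 _ _; move=> [a [b [ab /subseq_rconsP [s|[t' et s]]]]].
  by apply: IH => //; exists a, b.
move: et; rewrite -[[:: a; b; a; b]]/(rcons [:: a; b; a] b) => /rcons_inj [et bz].
subst t'; have bw : b \in decode w by apply: (mem_subseq s); rewrite !inE eqxx orbT.
have : z \in rcons (open_blocks w) (nblocks (decode w)).+1 by rewrite mem_nth // size_rcons.
rewrite mem_rcons in_cons -bz => /orP [/eqP|bs].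
  by move: (leq_nblocks bw); lia.
have : subseq [:: b; a] (decode w) by apply: subseq_trans s; rewrite subseq_cons.
by move/(live _ _ bs); lia.
Qed.

(** The stack followed by the new block has no repetition, so the last letter determines the last
    level. *)
Lemma decode_inj w1 w2 : level_word w1 -> level_word w2 -> decode w1 = decode w2 -> w1 = w2.
Proof.
elim/last_ind: w1 w2 => [|w1 h1 IH] w2 l1 l2 e.
  by move: (size_dec w2); rewrite -e; case: w2 {l2 e}.
case/lastP: w2 l2 e => [|w2 h2] l2 e.
  by move: (size_dec (rcons w1 h1)); rewrite e size_rcons.
move: l1 l2 e; rewrite !level_word_rcons => /andP [l1 h1P] /andP [l2 h2P].
case: h1 h1P => // k1 k1P; case: h2 h2P => // k2 k2P.
have [_ s1 so1 sub1 _ _] := decode_invP l1; have [_ s2 _ _ _ _] := decode_invP l2.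
have [|-> _] := @decode_rcons w1 k1; first by rewrite s1.
have [|-> _] := @decode_rcons w2 k2; first by rewrite s2.
move=> /rcons_inj [/(IH _ l1 l2) e]; subst w2 => /eqP.
rewrite nth_uniq ?size_rcons ?s1 //; first by move/eqP ->.
rewrite rcons_uniq (sorted_uniq ltn_trans ltnn so1) andbT.
by apply/negP => /(mem_subseq sub1) /leq_nblocks; rewrite ltnn.
Qed.

(** A last letter [x] neither new nor on the stack is, by [inv_dead], preceded by some [c; x; c], so
    adding it would create a crossing. *)
Lemma decode_surj s :
  is_partition s -> noncrossing s -> exists2 w, level_word w & decode w = s.
Proof.
move=> + /noncrossingP; elim/last_ind: s => [_ _|s x IH]; first by exists [::].
rewrite is_partition_rcons => /andP [ps xs] nc.
case: IH => // [[a [b [ab sub]]]|w lw ew].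
  by apply: nc; exists a, b; split => //; apply: subseq_trans sub (subseq_rcons _ _).
have [pw sw so sub live dead] := decode_invP lw.
have : x \in rcons (open_blocks w) (nblocks (decode w)).+1.
  rewrite mem_rcons in_cons; case: eqP => //= xn; apply/negPn/negP => xst.
  have [||c cx sc] := dead x => //; first by rewrite ew partition_mem //; move: xn; rewrite ew; lia.
  apply: nc; exists c, x; split; first by case/andP: cx.
  by rewrite -[[:: c; x; c; x]]/(rcons [:: c; x; c] x) subseq_rcons2 // -ew.
move=> /(nthP 0) [k]; rewrite size_rcons ltnS => kst ex.
exists (rcons w k.+1); first by rewrite level_word_rcons lw /= -sw.
by have [-> _] := decode_rcons kst; rewrite ex ew.
Qed.

(** * Concatenation and components in terms of levels *)

Lemma nblocks_shift k v : maxn k (nblocks (map (addn k) v)) = k + nblocks v.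
Proof. by elim: v => [|x v IH] /=; lia. Qed.

Lemma nblocks_pjoin a b : nblocks (pjoin a b) = nblocks a + nblocks b.
Proof. by rewrite nblocks_cat nblocks_shift. Qed.

(** Levels raised by [size st] never reach down into [st], so [w] is decoded on top of it as from
    scratch. *)
Lemma run_shift u0 st w (k := nblocks u0) :
  level_word w ->
  run (u0, st) (map (addn (size st)) w)
  = (u0 ++ map (addn k) (decode w), st ++ map (addn k) (open_blocks w)).
Proof.
elim/last_ind: w => [|w h IH]; first by rewrite /= !cats0.
rewrite level_word_rcons map_rcons run_rcons => /andP [lw]; rewrite IH //.
case: h => // j; rewrite /= ltnS -(inv_size (decode_invP lw)) => jw.
have [-> ->] := decode_rcons jw; rewrite addnS decode_stepS; last first.
  by rewrite size_cat size_map leq_add2l.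
rewrite /= nblocks_cat nblocks_shift take_cat ltnNge leq_addr /= addKn.
rewrite !rcons_cat nth_cat ltnNge leq_addr /= addKn !map_rcons -/k -addnS.
rewrite -map_rcons (nth_map 0); last by rewrite size_rcons ltnS.
by rewrite map_take.
Qed.

Definition ljoin v w := v ++ map (addn (last 0 v)) w.

Lemma last_ljoin v w : last 0 (ljoin v w) = last 0 v + last 0 w.
Proof. by rewrite /ljoin last_cat -{1}[last 0 v]addn0 last_map. Qed.

Lemma level_word_ljoin v w : level_word v -> level_word w -> level_word (ljoin v w).
Proof.
move=> lv lw; rewrite /level_word /level_path cat_path [path _ _ v]lv.
rewrite -{1}[last 0 v]addn0 path_map /=.
by apply: sub_path lw => x y /=; lia.
Qed.

Lemma decode_ljoin v w :
  level_word v -> level_word w -> decode (ljoin v w) = pjoin (decode v) (decode w).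
Proof.
move=> lv lw; rewrite /decode /ljoin /run foldl_cat -/run.
rewrite [run _ v]surjective_pairing -/(decode v) -/(open_blocks v) -(inv_size (decode_invP lv)).
by rewrite run_shift.
Qed.

Lemma stk_ljoin v w :
  level_word v -> level_word w ->
  open_blocks (ljoin v w) = open_blocks v ++ map (addn (nblocks (decode v))) (open_blocks w).
Proof.
move=> lv lw; rewrite /open_blocks /ljoin /run foldl_cat -/run.
rewrite [run _ v]surjective_pairing -/(decode v) -/(open_blocks v) -(inv_size (decode_invP lv)).
by rewrite run_shift.
Qed.

(** Cut after the last level at most [m] (at the start if [m] is 0): the next level exceeds [m] and
    rises by at most one, so the first part ends exactly at [m]. *)
Lemma level_word_split m w :
  level_word w -> m < last 0 w ->
  exists v r, [/\ w = ljoin v r, level_word v, last 0 v = m & level_word r].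
Proof.
elim/last_ind: w => // w x IH; rewrite level_word_rcons last_rcons => /andP [lw xw] mx.
case: (ltnP m (last 0 w)) => mw.
  have [v [r [ew lv lm lr]]] := IH lw mw.
  exists v, (rcons r (x - m)); split=> //.
    by rewrite /ljoin map_rcons -rcons_cat -/(ljoin v r) -ew lm subnKC // ltnW.
  by rewrite level_word_rcons lr; move: xw; rewrite ew last_ljoin; lia.
have em : last 0 w = m by lia.
exists w, [:: 1]; split=> //; rewrite /ljoin em cats1 /=; congr rcons; lia.
Qed.

Lemma decode_nil w : decode w = [::] -> w = [::].
Proof. by move=> e; move: (size_dec w); rewrite e; case: w {e}. Qed.

Lemma head_stk w : level_word w -> w != [::] -> exists st, open_blocks w = 1 :: st.
Proof.
elim/last_ind: w => // w x IH; rewrite level_word_rcons => /andP [lw].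
case: x => // k; rewrite ltnS /= -(inv_size (decode_invP lw)) => kw _.
have [_ ->] := decode_rcons kw.
have [ew|nw] := eqVneq w [::]; first by move: kw; rewrite ew; case: k => // _; exists [::].
have [st es] := IH lw nw.
by rewrite es; case: k {kw} => [|k] /=; [exists [::] | eexists].
Qed.

Lemma last_dec w : level_word w -> last 0 w = 1 -> open_blocks w = [:: 1] /\ last 0 (decode w) = 1.
Proof.
move=> lw l1; have nw : w != [::] by case: (w) l1.
have [st es] := head_stk lw nw; have := inv_size (decode_invP lw).
rewrite es l1 => - [] /size0nil e; split; first by rewrite e.
case/lastP: w lw l1 es nw => // w x; rewrite level_word_rcons last_rcons => /andP [lw xw] x1 es _.
move: es xw; rewrite x1 => es xw.
have [-> eq] := @decode_rcons w 0 (leq0n _); rewrite last_rcons.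
by move: eq; rewrite es take0 /= => - [].
Qed.

(** A final level above 1 allows a cut one level lower. With final level 1 the word ends in the
    letter 1, whereas a proper concatenation ends in a larger letter. *)
Lemma connected_dec w : level_word w -> connected (decode w) <-> last 0 w = 1.
Proof.
move=> lw; split=> [[_ [nz nsplit]]|l1].
  case: (ltngtP (last 0 w) 1) => // [|l2].
    case/lastP: w lw nz {nsplit} => // w x; rewrite level_word_rcons last_rcons; lia.
  case: nsplit; have [v [r [ew lv lm lr]]] := level_word_split lw (m := (last 0 w).-1) ltac:(lia).
  exists (decode v), (decode r).
  rewrite ew decode_ljoin // (inv_part (decode_invP lv)) (inv_part (decode_invP lr)).
  by split=> //; split=> //; split; [|split=> //] => /decode_nil e;
    move: lm l2; rewrite ew last_ljoin e /=; lia.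
have [es ed] := last_dec lw l1.
split; first exact: inv_part (decode_invP lw).
split=> [/decode_nil e|]; first by rewrite e in l1.
move=> [a [b [pa [pb [na [nb e]]]]]]; move: ed; rewrite e /pjoin last_cat.
case/lastP: b nb pb {e} => // b x _; rewrite is_partition_rcons map_rcons last_rcons.
case: a na pa => // y a _ pa; have := partition_gt0 pa (mem_head _ _).
move: (leq_nblocks (mem_head y a)) => yn y0 /andP [_ /andP [x0 _]]; set N := nblocks _ in yn *. lia.
Qed.

Lemma crossing_subseq s1 s2 : subseq s1 s2 -> crossing s1 -> crossing s2.
Proof. by move=> s12 [a [b [ab s]]]; exists a, b; split=> //; apply: subseq_trans s12. Qed.

Lemma crossing_shift k s : crossing s -> crossing (map (addn k) s).
Proof.
move=> [a [b [ab s4]]]; exists (k + a), (k + b); split; first by rewrite ltn_add2l.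
exact: (map_subseq (addn k) s4).
Qed.

(** Final levels add up under concatenation, and each connected component contributes 1. *)
Lemma has_ncomp_dec w m : level_word w -> has_ncomp (decode w) m <-> last 0 w = m.
Proof.
move=> lw; split=> [[cs [<- [conn e]]]|].
  elim/last_ind: cs w lw conn e => [|cs c IH] w lw conn; first by move/decode_nil ->.
  rewrite foldl_rcons size_rcons; set a := foldl _ _ cs => e.
  have pw := inv_part (decode_invP lw); have ncw := decode_noncrossing lw.
  have [||v lv ev] := @decode_surj a.
  - by move: pw; rewrite e; apply: is_partition_prefix.
  - apply/noncrossingP => /crossing_subseq cr; apply: ncw; apply: cr.
    by rewrite e prefix_subseq.
  have cc : connected c by apply: conn; rewrite mem_rcons mem_head.
  have [||r lr er] := @decode_surj c; first by case: cc.
    apply/noncrossingP => /(crossing_shift (nblocks a)) /crossing_subseq cr.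
    by apply: ncw; apply: cr; rewrite e suffix_subseq.
  have -> : w = ljoin v r.
    by apply: decode_inj; rewrite ?level_word_ljoin ?decode_ljoin // e ev er.
  rewrite last_ljoin (IH v) //; last first.
    by move=> c' c'cs; apply: conn; rewrite mem_rcons in_cons c'cs orbT.
  by move: cc; rewrite -er => /(connected_dec lr) ->; rewrite addn1.
elim: m w lw => [|m IH] w lw lm.
  exists [::]; split=> //; split=> //; case/lastP: w lw lm => // w x.
  by rewrite level_word_rcons last_rcons; lia.
have [v [r [ew lv lvm lr]]] := level_word_split lw (m := m) ltac:(lia).
have [cs [<- [conn e]]] := IH v lv lvm; exists (rcons cs (decode r)).
rewrite size_rcons foldl_rcons -e ew decode_ljoin //; split=> //; split=> // c.
rewrite mem_rcons in_cons => /orP [/eqP ->|]; last exact: conn.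
by apply/connected_dec => //; move: lm; rewrite ew last_ljoin; lia.
Qed.

(** * Weaving two non-crossing partitions *)

(* The suffix [S] reuses letters of the [i] blocks open on the left and encloses a
   partition [B] placed on top of them; [unweave] separates [B] from the list of
   reused letters, each recorded as (rank of the letter, number of components of
   [B] closed before it). State: [t] is the current level of [B], of which the
   lowest [g] are closed, so that the current level of the word is [i + t - g]. *)
Fixpoint unweave (i g t : nat) (S : seq nat) : seq nat * seq (nat * nat) :=
  if S is h :: S' then
    if h <= i then let BM := unweave h t t S' in (BM.1, (h, t) :: BM.2)
    else let x := h - i + g in let BM := unweave i g x S' in (x :: BM.1, BM.2)
  else ([::], [::]).

(** Inverse of [unweave]. The gap [t] comes after the last level of [B] that is at most [t], hence
    the test that all later levels exceed [t]. The inner fixpoint puts several letters into one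
    gap. *)
Fixpoint weave (B : seq nat) : seq (nat * nat) -> nat -> nat -> nat -> seq nat :=
  fix weave_in M i g t :=
    let next := if B is x :: B' then (x - g + i) :: weave B' M i g x else [::] in
    if M is (i1, g1) :: M' then
      if (g1 == t) && all (ltn t) B then i1 :: weave_in M' i1 g1 t else next
    else next.

(** Reusing a block closes those above it, so ranks weakly decrease, while gaps are met from left to
    right. *)
Fixpoint chain (i g c : nat) (M : seq (nat * nat)) : bool :=
  if M is (i1, g1) :: M' then [&& 0 < i1 <= i, g <= g1 <= c & chain i1 g1 c M'] else true.

(* The gaps of [B] still available from level [t] on start at [low t B]. *)
Definition low (t : nat) (B : seq nat) := foldr minn t B.

Lemma lowP g t B : g < low t B -> all (ltn g) B /\ g < t.
Proof.
by elim: B => //= x B IH; rewrite leq_min => /andP [-> /IH [-> ->]].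
Qed.

Lemma low_all t B : all (ltn t) B -> low t B = t.
Proof. by elim: B => //= x B IH /andP [xt /IH ->]; lia. Qed.

Lemma low_step t x B : low t (x :: B) = minn t (low x B).
Proof. by elim: B t x => [|y B IH] t x /=; [lia|move: (IH t x) (IH x x) => /=; lia]. Qed.

Lemma low_le t B : low t B <= last t B.
Proof.
elim: B t => [|x B IH] t /=; first by rewrite leqnn.
by rewrite -[minn _ _]/(low t (x :: B)) low_step; move: (IH x); lia.
Qed.

Lemma chain_weaken i g g' c M : g' <= g -> chain i g c M -> chain i g' c M.
Proof. by case: M => [|[i1 g1] M] //= gg /and3P [-> /andP [h ->] ->]; rewrite (leq_trans gg). Qed.

Lemma weave_ins B M h i g t :
  all (ltn t) B -> weave B ((h, t) :: M) i g t = h :: weave B M h t t.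
Proof. by case: B => [|x B] /= aB; rewrite eqxx ?aB. Qed.

Lemma unweaveP i g t S (BM := unweave i g t S) :
  g <= t -> level_path (i + t - g) S ->
  [/\ level_path t BM.1, all (ltn g) BM.1, chain i (low t BM.1) (last t BM.1) BM.2
   & weave BM.1 BM.2 i g t = S].
Proof.
rewrite {}/BM; elim: S i g t => [|h S IH] i g t gt //=.
move=> /andP [h1 pS]; case: leqP => hi.
  have [|pB aB cM eS] := IH h t t (leqnn _); first by rewrite addnK.
  have lt := low_all aB; rewrite lt in cM.
  split=> //=; first by apply: sub_all aB => x; apply: leq_ltn_trans.
    have := low_le t (unweave h t t S).1; rewrite lt => ->.
    by rewrite leqnn cM hi; case/andP: h1 => ->.
  by rewrite weave_ins // eS.
have [||pB aB cM eS] := IH i g (h - i + g); first lia.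
  by move: pS; congr (level_path _ _); lia.
split=> /=.
- by rewrite pB andbT; lia.
- by rewrite aB andbT; lia.
- by rewrite -[minn _ _]/(low t (_ :: _)) low_step; apply: chain_weaken cM; apply: geq_minr.
case E: (unweave i g (h - i + g) S).2 cM => [|[i1 g1] M] /=.
  by move=> _; rewrite -E eS; congr (_ :: _); lia.
move=> /and3P [_ /andP [lg _] _]; case: ifP => [/and3P [/eqP eg th aM]|_].
  suff : t < low (h - i + g) (unweave i g (h - i + g) S).1 by lia.
  elim: (_.1) aM => [|y B IHB] //= /andP [ty /IHB]; rewrite leq_min ty; exact.
by rewrite -E eS; congr (_ :: _); lia.
Qed.

Lemma weaveP i g t B M :
  g <= t -> level_path t B -> all (ltn g) B -> chain i (low t B) (last t B) M ->
  level_path (i + t - g) (weave B M i g t) /\ unweave i g t (weave B M i g t) = (B, M).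
Proof.
elim: B M i g t => [|x B IHB].
  elim=> [|[i1 g1] M IHM] i g t gt _ _; first by split.
  rewrite /low /= => /and3P [i1P gP cM].
  have e : g1 = t by lia.
  subst g1; have [pm um] := IHM i1 t t (leqnn _) isT isT cM.
  move: pm um; rewrite addnK eqxx /= => -> ->; case/andP: i1P => -> ii.
  by rewrite ii; split=> //; lia.
elim=> [|[i1 g1] M IHM] i g t gt pB aB cM.
  rewrite /=; have /= /andP [xt pB'] := pB; have /= /andP [gx aB'] := aB.
  have [|pm um] := IHB [::] i g x (ltnW gx) pB' aB' => //.
  have -> : (x - g + i <= i) = false by lia.
  have -> : x - g + i - i + g = x by lia.
  rewrite um; split=> //; rewrite -/(level_path _ _); apply/andP; split; first lia.
  by move: pm; congr (level_path _ _); lia.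
move: cM => /= /and3P [i1P gP cM]; case: ifP => [/andP [/eqP e aB']|naB].
  subst g1; rewrite -[RHS]/(x :: B, (i1, t) :: M).
  have lt : low t (x :: B) = t := low_all (B := x :: B) aB'.
  have [|pm um] := IHM i1 t t (leqnn _) pB aB'; first by rewrite lt.
  rewrite addnK in pm; rewrite [unweave _ _ _ _]/= [level_path _ _]/=.
  case/andP: i1P => i10 ii; rewrite ii.
  rewrite -[X in unweave _ _ _ X]/(weave (x :: B) M i1 t t) um.
  by split=> //; rewrite i10 /=; apply/andP; split; [lia|exact: pm].
have /= /andP [xt pB'] := pB; have /= /andP [gx aB'] := aB.
have [|pm um] := IHB ((i1, g1) :: M) i g x (ltnW gx) pB' aB'.
  rewrite /= i1P cM andbT /=; case/andP: gP => gP ->; rewrite andbT leqNgt.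
  apply/negP => lg; have [ag gx'] := lowP lg; case: naB.
  (* Levels rise by at most one, so a gap below everything from [x] on is at most [t]; the chain
     bound gives equality, and the insertion test would have succeeded. *)
  have e : g1 = t by move: gP; rewrite -[minn _ _]/(low t (x :: B)) low_step; lia.
  by rewrite -e eqxx gx' ag.
rewrite [unweave _ _ _ _]/= [level_path _ _]/=.
have -> : (x - g + i <= i) = false by lia.
have -> : x - g + i - i + g = x by lia.
rewrite um; split=> //; rewrite -/(level_path _ _); apply/andP; split; first lia.
by move: pm; congr (level_path _ _); lia.
Qed.

Lemma size_unweave i g t S :
  size S = size (unweave i g t S).1 + size (unweave i g t S).2.
Proof.
by elim: S i g t => //= h S IH i g t; case: ifP => _ /=; rewrite ?addnS ?addSn -IH.
Qed.

Lemma last_unweave i g t S (l := last (i, g) (unweave i g t S).2) :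
  g <= t -> level_path (i + t - g) S ->
  last (i + t - g) S = l.1 + last t (unweave i g t S).1 - l.2.
Proof.
rewrite {}/l; elim: S i g t => //= h S IH i g t gt /andP [_ pS].
case: leqP => hi /=; first by rewrite -IH ?addnK.
have e : h = i + (h - i + g) - g by lia.
by rewrite {1}e IH -?e //; lia.
Qed.

(* Exchanges the roles of the two woven partitions, of [a] and [b] components:
   a letter of rank [i] becomes the gap [a + 1 - i], and the gap [g] becomes the
   letter of rank [b + 1 - g]. *)
Definition flip a b (M : seq (nat * nat)) := [seq (b.+1 - p.2, a.+1 - p.1) | p <- M].

Lemma chain_flip_from a b i g M :
  i <= a.+1 -> chain i g b M -> chain (b.+1 - g) (a.+1 - i) a (flip a b M).
Proof.
elim: M i g => //= -[i1 g1] M IH i g ia /= /and3P [iP gP cM].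
by rewrite IH //; lia.
Qed.

Lemma chain_flip a b M : chain a.+1 0 b M -> chain b.+1 0 a (flip a b M).
Proof. by move/(chain_flip_from (leqnn _)); rewrite subnn subn0. Qed.

Lemma flipK a b i g M : i <= a.+1 -> chain i g b M -> flip b a (flip a b M) = M.
Proof.
elim: M i g => //= -[i1 g1] M IH i g ia /= /and3P [iP gP cM].
rewrite (IH i1 g1) //; last lia.
by congr ((_, _) :: _); lia.
Qed.

(** The default [(a.+1, 0)] is sent to [(b.+1, 0)], so an empty [M] needs no separate case. *)
Lemma last_flip a b M :
  last (b.+1, 0) (flip a b M) = (b.+1 - (last (a.+1, 0) M).2, a.+1 - (last (a.+1, 0) M).1).
Proof. by rewrite -(last_map (fun p => (b.+1 - p.2, a.+1 - p.1))) /= subnn subn0. Qed.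

Lemma chain_last i g c M (l := last (i, g) M) :
  0 < i -> g <= c -> chain i g c M -> 0 < l.1 <= i /\ g <= l.2 <= c.
Proof.
rewrite {}/l; elim: M i g => [|[i1 g1] M IH] i g i0 gc /=; first by move=> _; lia.
by move=> /and3P [iP gP /IH]; lia.
Qed.

(** * Splitting a level word at a position *)

Definition compose (A r B : seq nat) M := ljoin A r ++ weave B M (last 0 A).+1 0 0.

Record wf_split (A r B : seq nat) M : Prop := Wf {
  wfA : level_word A; wfr : level_word r; wf1 : last 0 r = 1; wfB : level_word B;
  wfM : chain (last 0 A).+1 0 (last 0 B) M }.

Lemma wf_flip A r B M : wf_split A r B M -> wf_split B r A (flip (last 0 A) (last 0 B) M).
Proof. by case=> *; split=> //; apply: chain_flip. Qed.

Lemma level_word_gt0 w : level_word w -> all (ltn 0) w.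
Proof.
rewrite /level_word; move: {1}0 => k.
by elim: w k => //= y s IH k /andP [/andP [-> _] /IH].
Qed.

Lemma wf_weave A r B M (S := weave B M (last 0 A).+1 0 0) :
  wf_split A r B M -> level_path (last 0 A).+1 S /\ unweave (last 0 A).+1 0 0 S = (B, M).
Proof.
case=> lA lr r1 lB cM; rewrite {}/S.
have aB := level_word_gt0 lB.
have [] := @weaveP (last 0 A).+1 0 0 B M => //; last by rewrite addn0 subn0.
have -> // : low 0 B = 0 by elim: (B) => //= x s ->; rewrite minn0.
Qed.

Lemma level_word_compose A r B M : wf_split A r B M -> level_word (compose A r B M).
Proof.
move=> wfD; have [pS _] := wf_weave wfD; case: wfD => lA lr r1 _ _.
rewrite /level_word /level_path cat_path [path _ _ _](level_word_ljoin lA lr).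
rewrite last_ljoin r1 addn1; exact: pS.
Qed.

Lemma size_compose A r B M :
  wf_split A r B M -> size (compose A r B M) = size A + size r + size B + size M.
Proof.
move=> /wf_weave [_ u]; rewrite !size_cat size_map.
rewrite [size (weave _ _ _ _ _)](size_unweave (last 0 A).+1 0 0) u.
by rewrite !addnA.
Qed.

Lemma last_compose A r B M (l := last ((last 0 A).+1, 0) M) :
  wf_split A r B M -> last 0 (compose A r B M) = l.1 + last 0 B - l.2.
Proof.
move=> wfD; have [pS u] := wf_weave wfD; rewrite last_cat last_ljoin (wf1 wfD) addn1.
have := @last_unweave (last 0 A).+1 0 0 _ (leqnn _); rewrite addn0 subn0.
by move=> /(_ _ pS) ->; rewrite u.
Qed.

(** Let [a], [b] be the final levels of [A], [B], and let [M] end with [(i, g)]. The final level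
    [i + b - g] becomes [(b + 1 - g) + a - (a + 1 - i)], the same number. *)
Lemma last_compose_flip A r B M :
  wf_split A r B M ->
  last 0 (compose B r A (flip (last 0 A) (last 0 B) M)) = last 0 (compose A r B M).
Proof.
move=> wfD; rewrite last_compose ?last_flip; last exact: wf_flip.
rewrite last_compose //=.
by have [] := chain_last (ltn0Sn _) (leq0n _) (wfM wfD); lia.
Qed.

Lemma size_compose_flip A r B M :
  wf_split A r B M ->
  size (compose B r A (flip (last 0 A) (last 0 B) M)) = size (compose A r B M).
Proof.
move=> wfD; rewrite !size_compose //; last exact: wf_flip.
by rewrite size_map; lia.
Qed.

(** The last component of the prefix ending at position [q] is [r], the earlier ones form [A], and
    the suffix is unwoven. *)
Lemma compose_cut w q :
  level_word w -> q < size w ->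
  exists A r B M, [/\ wf_split A r B M, w = compose A r B M & size A + size r = q.+1].
Proof.
move=> lw qw; have := lw; rewrite -(cat_take_drop q.+1 w) /level_word /level_path cat_path.
rewrite -/(level_path 0 _) -/(level_word _).
set P := take _ w; set S := drop _ w => /andP [lP pS].
have szP : size P = q.+1 by rewrite size_takel.
have lP0 : 0 < last 0 P.
  case/lastP: (P) szP lP => // s x _; rewrite level_word_rcons last_rcons; lia.
have [A [r [eP lA lAm lr]]] := level_word_split lP (m := (last 0 P).-1) ltac:(lia).
have r1 : last 0 r = 1 by move: lP0 lAm; rewrite eP last_ljoin; lia.
have eS : last 0 P = (last 0 A).+1 by rewrite eP last_ljoin r1 addn1.
have := @unweaveP (last 0 A).+1 0 0 S (leqnn _); rewrite addn0 subn0 -eS.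
move=> /(_ pS) [lB _ cM mS].
exists A, r, (unweave (last 0 P) 0 0 S).1, (unweave (last 0 P) 0 0 S).2.
split; last by rewrite -szP eP size_cat size_map.
- by split=> //; rewrite -eS; apply: chain_weaken cM.
- by rewrite /compose -eS mS -eP.
Qed.

Lemma ljoin_inj A1 r1 A2 r2 :
  last 0 A1 = last 0 A2 -> all (ltn 0) r1 -> all (ltn 0) r2 ->
  ljoin A1 r1 = ljoin A2 r2 -> A1 = A2 /\ r1 = r2.
Proof.
wlog le : A1 r1 A2 r2 / size A1 <= size A2.
  move=> H el p1 p2 e; case: (leqP (size A1) (size A2)) => [|/ltnW] le.
    exact: H le el p1 p2 e.
  by have [-> ->] := H _ _ _ _ le (esym el) p2 p1 (esym e).
move=> el p1 _ e; have eA : size A1 = size A2.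
  apply/eqP; rewrite eqn_leq le leqNgt; apply/negP => lt.
  (* If [A1] were shorter, this position would carry the common final level in one word but a higher
     level, coming from the raised [r1], in the other. *)
  have : nth 0 (ljoin A1 r1) (size A2).-1 = last 0 A2.
    by rewrite e /ljoin nth_cat; case: ltnP => [_|]; [rewrite nth_last|lia].
  have szr : (size A2).-1 - size A1 < size r1.
    by have := congr1 size e; rewrite !size_cat !size_map; lia.
  rewrite /ljoin nth_cat ltnNge -ltnS (ltn_predK lt) lt /= (nth_map 0) // -el.
  by move: (allP p1 _ (mem_nth 0 szr)) => /=; lia.
move/eqP: e; rewrite /ljoin eqseq_cat // el => /andP [/eqP -> /eqP].
by move/(inj_map (@addnI _)).
Qed.

Lemma compose_inj A1 r1 B1 M1 A2 r2 B2 M2 :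
  wf_split A1 r1 B1 M1 -> wf_split A2 r2 B2 M2 ->
  compose A1 r1 B1 M1 = compose A2 r2 B2 M2 -> size A1 + size r1 = size A2 + size r2 ->
  [/\ A1 = A2, r1 = r2, B1 = B2 & M1 = M2].
Proof.
move=> w1 w2 e sz; have [_ u1] := wf_weave w1; have [_ u2] := wf_weave w2.
have szj : size (ljoin A1 r1) = size (ljoin A2 r2) by rewrite !size_cat !size_map.
move/eqP: e; rewrite /compose eqseq_cat // => /andP [/eqP eP /eqP eS].
have : last 0 (ljoin A1 r1) = last 0 (ljoin A2 r2) by rewrite eP.
rewrite !last_ljoin (wf1 w1) (wf1 w2) => /addIn el.
have [eA er] := ljoin_inj el (level_word_gt0 (wfr w1)) (level_word_gt0 (wfr w2)) eP.
by move: u1; rewrite eS eA u2 => - [-> ->].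
Qed.

(** * Decoding a composed level word *)

Lemma run_prefix us w : exists Z, (run us w).1 = us.1 ++ Z.
Proof.
elim/last_ind: w => [|w x [Z IH]]; first by exists [::]; rewrite cats0.
by eexists; rewrite run_rcons /= IH rcons_cat.
Qed.

Lemma last_in (T : eqType) (x : T) s : 0 < size s -> last x s \in s.
Proof. by case: s => //= y s _; exact: mem_last. Qed.

Lemma filter_run S a N F i g u SA v stB :
  g <= size stB -> level_path (i + size stB - g) S ->
  size SA = i -> all (geq a) SA -> a <= N -> all (ltn 0) stB ->
  filter (ltn a) u = F ++ map (addn N) v -> nblocks u = N + nblocks v ->
  filter (ltn a) (run (u, SA ++ map (addn N) (drop g stB)) S).1
  = F ++ map (addn N) (run (v, stB) (unweave i g (size stB) S).1).1.
Proof.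
elim: S i g u SA v stB => [|h S IH] i g u SA v stB gt //= /andP [hP pS] si aSA aN pB eu nu.
case: leqP => hi /=.
  rewrite /decode_step /= rcons_cat takel_cat ?si //.
  have za : last 0 (take h SA) <= a.
    have : last 0 (take h SA) \in take h SA.
      by apply: last_in; rewrite size_takel ?si //; case/andP: hP.
    by move/mem_take/(allP aSA).
  move: (last 0 _) za => z za.
  rewrite -[take h SA]cats0 -[[::]]/(map (addn N) [::]) -(drop_size stB).
  apply: IH => //; rewrite ?addnK ?size_takel ?si //.
  - by apply/allP => y /mem_take /(allP aSA).
  - by rewrite -cats1 filter_cat eu /= ltnNge za cats0.
  - by rewrite nblocks_rcons nu; lia.
rewrite /decode_step /= nu rcons_cat -addnS -map_rcons -drop_rcons //.
set R := rcons stB _; rewrite take_cat si ltnNge (ltnW hi) /= -map_take take_drop.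
set x := h - i + g; have xs : size (take x R) = x by rewrite size_takel // size_rcons; lia.
case/lastP E: (take x R) xs => [|T y]; first by rewrite /x /=; lia.
rewrite -E => xs.
have y0 : 0 < y.
  have : y \in take x R by rewrite E mem_rcons mem_head.
  by move/mem_take; rewrite mem_rcons in_cons => /orP [/eqP ->|/(allP pB)].
have -> : last 0 (SA ++ map (addn N) (drop g (take x R))) = N + y.
  rewrite E drop_rcons ?map_rcons ?last_cat ?last_rcons //.
  by move: xs; rewrite E size_rcons /x; lia.
have -> : last 0 (take x R) = y by rewrite E last_rcons.
have := IH i g (rcons u (N + y)) SA (rcons v y) (take x R); rewrite xs; apply => //.
- by rewrite /x leq_addl.
- by have -> : i + x - g = h by lia.
- by apply/allP => b /mem_take; rewrite mem_rcons in_cons => /orP [/eqP ->|/(allP pB)].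
- rewrite -cats1 filter_cat eu map_rcons /= ifT; last lia.
  by rewrite -catA cats1.
- by rewrite !nblocks_rcons nu; lia.
Qed.

Lemma decode_compose A r B M (N := nblocks (decode A) + nblocks (decode r)) :
  wf_split A r B M ->
  exists2 Z, decode (compose A r B M) = pjoin (decode A) (decode r) ++ Z
           & filter (ltn (nblocks (decode A)).+1) Z = map (addn N) (decode B).
Proof.
move=> wfD; have [pS u] := wf_weave wfD; case: wfD => lA lr r1 lB _.
rewrite /decode /compose /run foldl_cat -/run.
rewrite [run _ (ljoin A r)]surjective_pairing -/(decode _) -/(open_blocks _).
have [Z eZ] := run_prefix (decode (ljoin A r), open_blocks (ljoin A r))
  (weave B M (last 0 A).+1 0 0).
exists Z; first by rewrite eZ /= decode_ljoin.
(* The cut-off is the letter that block 1 of [r] receives in the composed word; at the start the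
   whole stack is [SA] and nothing of [B] has been read. *)
have := @filter_run (weave B M (last 0 A).+1 0 0) (nblocks (decode A)).+1 N
   (filter (ltn (nblocks (decode A)).+1) (decode (ljoin A r))) (last 0 A).+1 0
   (decode (ljoin A r)) (open_blocks (ljoin A r)) [::] [::] isT.
rewrite u !cats0 eZ filter_cat /= addn0 subn0 => H.
suff /eqP : filter (ltn (nblocks (decode A)).+1) (decode (ljoin A r)) ++
  filter (ltn (nblocks (decode A)).+1) Z =
  filter (ltn (nblocks (decode A)).+1) (decode (ljoin A r)) ++ map (addn N) (decode B).
  by rewrite eqseq_cat // eqxx => /eqP.
have nr : 0 < nblocks (decode r).
  have [_ ld] := last_dec lr r1; rewrite -ld; apply: leq_nblocks; apply: last_in.
  by rewrite size_dec; case: (r) r1.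
apply: H => //.
- by rewrite (inv_size (decode_invP (level_word_ljoin lA lr))) last_ljoin r1 addn1.
- rewrite stk_ljoin // (last_dec lr r1).1 all_cat /= addn1 leqnn !andbT.
  apply/allP => b /(mem_subseq (inv_sub (decode_invP lA))) /leq_nblocks bn.
  by rewrite /= ltnW.
- by rewrite /N -addn1 leq_add2l.
- by rewrite decode_ljoin // nblocks_pjoin addn0.
Qed.

(** * Pattern occurrences *)

Lemma order_isoP t p :
  reflect (size t = size p /\ forall i j, i < size p -> j < size p ->
             (nth 0 t i < nth 0 t j) = (nth 0 p i < nth 0 p j)) (order_iso t p).
Proof.
apply: (iffP andP) => [[/eqP st /allP H]|[st H]]; split; rewrite ?st //.
  move=> i j ip jp.
  have /H /allP /(_ j) : i \in iota 0 (size p) by rewrite mem_iota.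
  by rewrite mem_iota => /(_ jp) /eqP.
apply/allP => i; rewrite mem_iota => ip; apply/allP => j; rewrite mem_iota => jp.
by rewrite H.
Qed.

Lemma order_iso_shift k t p : order_iso (map (addn k) t) p = order_iso t p.
Proof.
apply/order_isoP/order_isoP; rewrite size_map => - [st H]; split=> // i j ip jp.
  by have := H i j ip jp; rewrite !(nth_map 0) ?st // ltn_add2l.
by rewrite !(nth_map 0) ?st // ltn_add2l; apply: H.
Qed.

Lemma contains_subseq s1 s2 p : subseq s1 s2 -> contains s1 p -> contains s2 p.
Proof. by move=> s12 [t [st tp]]; exists t; split=> //; apply: subseq_trans s12. Qed.

Lemma contains_shift k s p : contains (map (addn k) s) p <-> contains s p.
Proof.
split=> [[t [st tp]]|[t [st tp]]].
  have /subseqP [m sm et] := st; exists (mask m s); split; first exact: mask_subseq.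
  by rewrite -(order_iso_shift k) map_mask -et.
by exists (map (addn k) t); split; [exact: map_subseq|rewrite order_iso_shift].
Qed.

Lemma order_iso_pjoin t p1 p2 :
  is_partition p2 -> order_iso t (pjoin p1 p2) ->
  exists t1 t2, [/\ t = t1 ++ t2, order_iso t1 p1, order_iso t2 p2
                  & forall x y, x \in t1 -> y \in t2 -> x < y].
Proof.
move=> pp2 /order_isoP; rewrite size_cat size_map => - [st H].
exists (take (size p1) t), (drop (size p1) t).
have s1 : size (take (size p1) t) = size p1 by rewrite size_takel // st leq_addr.
have s2 : size (drop (size p1) t) = size p2 by rewrite size_drop st addKn.
split; first by rewrite cat_take_drop.
- apply/order_isoP; split=> // i j ip jp; rewrite !nth_take // H ?ltn_addr //.
  by rewrite !nth_cat ip jp.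
- apply/order_isoP; split=> // i j ip jp; rewrite !nth_drop H ?ltn_add2l //.
  by rewrite !nth_cat !ltnNge !leq_addr /= !addKn !(nth_map 0) // leq_add2l.
move=> x y /(nthP 0) [i]; rewrite s1 => i1 <- /(nthP 0) [j]; rewrite s2 => j2 <-.
rewrite nth_take // nth_drop H ?ltn_add2l ?ltn_addr // !nth_cat i1.
rewrite [_ + _ < _]ltnNge leq_addr /= addKn.
rewrite (nth_map 0) //; have le1 : nth 0 p1 i <= nblocks p1 := leq_nblocks (mem_nth 0 i1).
by have gt2 : 0 < nth 0 p2 j := partition_gt0 pp2 (mem_nth 0 j2); lia.
Qed.

Lemma pjoin_order_iso t1 t2 p1 p2 :
  is_partition p2 -> order_iso t1 p1 -> order_iso t2 p2 ->
  (forall x y, x \in t1 -> y \in t2 -> x < y) -> order_iso (t1 ++ t2) (pjoin p1 p2).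
Proof.
move=> pp2 /order_isoP [s1 H1] /order_isoP [s2 H2] lt; apply/order_isoP.
rewrite !size_cat size_map s1 s2; split=> // i j ip jp.
have p2gt k : k < size p2 -> 0 < nth 0 p2 k.
  by move=> kp; apply: partition_gt0 pp2 (mem_nth 0 kp).
have le1 k : k < size p1 -> nth 0 p1 k <= nblocks p1.
  by move=> kp; apply: leq_nblocks; apply: mem_nth.
rewrite !nth_cat s1; case: (ltnP i (size p1)) => i1; case: (ltnP j (size p1)) => j1.
- exact: H1.
- have j2 : j - size p1 < size p2 by lia.
  rewrite lt ?mem_nth ?s1 ?s2 // (nth_map 0) //.
  by move: (p2gt _ j2) (le1 _ i1); lia.
- have i2 : i - size p1 < size p2 by lia.
  have := lt (nth 0 t1 j) (nth 0 t2 (i - size p1)); rewrite !mem_nth ?s1 ?s2 // (nth_map 0) //.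
  by move: (p2gt _ i2) (le1 _ j1) => ? ? /(_ isT isT); lia.
have i2 : i - size p1 < size p2 by lia.
have j2 : j - size p1 < size p2 by lia.
by rewrite !(nth_map 0) // H2 // ltn_add2l.
Qed.

Lemma contains_pjoinl s p1 p2 : is_partition p2 -> contains s (pjoin p1 p2) -> contains s p1.
Proof.
move=> pp2 [t [st /(order_iso_pjoin pp2) [t1 [t2 [et i1 _ _]]]]]; exists t1; split=> //.
by apply: subseq_trans st; rewrite et prefix_subseq.
Qed.

Lemma contains_pjoinr s p1 p2 : is_partition p2 -> contains s (pjoin p1 p2) -> contains s p2.
Proof.
move=> pp2 [t [st /(order_iso_pjoin pp2) [t1 [t2 [et _ i2 _]]]]]; exists t2; split=> //.
by apply: subseq_trans st; rewrite et suffix_subseq.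
Qed.

Lemma subseq_catE (t u v : seq nat) :
  subseq t (u ++ v) -> exists t1 t2, [/\ t = t1 ++ t2, subseq t1 u & subseq t2 v].
Proof.
move/subseqP => [m sm ->]; rewrite -(cat_take_drop (size u) m) mask_cat; last first.
  by rewrite size_takel // sm size_cat leq_addr.
by do 2!eexists; split; [reflexivity| |]; apply: mask_subseq.
Qed.

Definition ends_min (t : seq nat) :=
  exists b, [/\ t <> [::], head 0 t = b, last 0 t = b & all (leq b) t].

(** A connected non-crossing partition begins and ends with 1. This is how connectedness enters the
    pattern arguments. *)
Lemma connected_ends sigma t :
  connected sigma -> noncrossing sigma -> order_iso t sigma -> ends_min t.
Proof.
move=> cs ncs /order_isoP [st H]; have [ps [nz _]] := cs.
have [w lw ew] := decode_surj ps ncs; subst sigma.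
have [_ l1] := last_dec lw (iffLR (connected_dec lw) cs).
have sz : 0 < size (decode w) by case: (decode w) nz.
have ge1 i : i < size (decode w) -> 0 < nth 0 (decode w) i.
  by move=> ip; apply: partition_gt0 ps (mem_nth 0 ip).
have h1 : nth 0 (decode w) 0 = 1.
  by case: (decode w) ps nz => //= x s; rewrite /is_partition /=; lia.
have ll : nth 0 (decode w) (size (decode w)).-1 = 1 by rewrite nth_last.
have lsz : (size (decode w)).-1 < size (decode w) by lia.
exists (nth 0 t 0); split; rewrite ?nth0 //.
- by move=> e; move: st sz; rewrite e /= => <-.
- rewrite -nth_last st -nth0; have := H _ _ sz lsz; have := H _ _ lsz sz.
  by rewrite h1 ll; lia.
apply/allP => x /(nthP 0) [i]; rewrite st => ip <-.
by rewrite -nth0 leqNgt H // h1 -leqNgt ge1.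
Qed.

Lemma subseq_cat_last (t1 t2 u v : seq nat) :
  t1 <> [::] -> subseq (t1 ++ t2) (u ++ v) ->
  subseq t1 u \/ subseq (last 0 t1 :: t2) v.
Proof.
case/lastP: t1 => // t x _ /subseq_catE [u1 [u2 [e s1 s2]]]; rewrite last_rcons.
have [lt|le] := ltnP (size t) (size u1).
  left; apply: subseq_trans s1.
  have -> : rcons t x = take (size t).+1 u1.
    by rewrite -(takel_cat u2) // -e take_size_cat // size_rcons.
  exact: take_subseq.
right; apply: subseq_trans s2.
have -> : u2 = drop (size u1) t ++ x :: t2.
  rewrite -(drop_size_cat u2 (erefl (size u1))) -e cat_rcons drop_cat.
  by move: le; case: ltngtP => // -> _; rewrite subnn drop0 drop_size.
exact: suffix_subseq.
Qed.

(** * Patterns whose occurrences begin and end with their least letter *)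

Section Pattern.

Variable sg : seq nat.
Hypothesis sg_ends : forall t, order_iso t sg -> ends_min t.

Lemma head_in (t : seq nat) : t <> [::] -> head 0 t \in t.
Proof. by case: t => // x t _; rewrite mem_head. Qed.

(** An occurrence meeting both words would begin at or below [k] and end above it, though its first
    and last letters agree. *)
Lemma split_ends u v k :
  (forall x, x \in u -> x <= k) -> (forall x, x \in v -> k < x) ->
  contains (u ++ v) sg -> contains u sg \/ contains v sg.
Proof.
move=> uk kv [t [/subseq_catE [t1 [t2 [et s1 s2]]] it]].
have [b [_ hb lb _]] := sg_ends it; rewrite et in hb lb it.
case: t1 et s1 hb lb it => [|x t1] et s1 hb lb it; first by right; exists t2.
case/lastP: t2 et s2 hb lb it => [|t2 y] et s2 hb lb it.
  by left; exists (x :: t1); rewrite cats0 in it.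
have /uk : x \in u by apply: (mem_subseq s1); rewrite mem_head.
have /kv : y \in v by apply: (mem_subseq s2); rewrite mem_rcons mem_head.
move: hb lb => /= ->; rewrite last_cat last_rcons => ->; lia.
Qed.

Definition minimal (u : seq nat) :=
  contains u sg /\ forall u' x, u = rcons u' x -> ~ contains u' sg.

(** If one were shorter, the longer one would contain the pattern without using its own last
    letter. *)
Lemma minimal_size u1 u2 z1 z2 :
  minimal u1 -> minimal u2 -> u1 ++ z1 = u2 ++ z2 -> size u1 = size u2.
Proof.
wlog le : u1 u2 z1 z2 / size u1 <= size u2.
  move=> H m1 m2 e; case: (leqP (size u1) (size u2)) => [|/ltnW] le.
    exact: H le m1 m2 e.
  by symmetry; apply: H le m2 m1 (esym e).
move=> [c1 _] [_ m2] e; apply/eqP; rewrite eqn_leq le leqNgt; apply/negP => lt.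
case/lastP: u2 le lt m2 e => // u2 x _; rewrite size_rcons ltnS => lt m2 e.
apply: (m2 _ _ erefl); apply: contains_subseq c1.
have -> : u1 = take (size u1) u2.
  by rewrite -(takel_cat (x :: z2)) // -cat_rcons -e take_size_cat.
exact: take_subseq.
Qed.

Lemma pjoin_gt u v x : is_partition v -> x \in map (addn (nblocks u)) v -> nblocks u < x.
Proof.
by move=> pv /mapP [y /(partition_gt0 pv) y0 ->]; rewrite -[ltnLHS]addn0 ltn_add2l.
Qed.

Lemma contains_pjoin_split u v :
  is_partition v -> contains (pjoin u v) sg -> contains u sg \/ contains v sg.
Proof.
move=> pv c; have := split_ends (@leq_nblocks u) (fun x => @pjoin_gt u v x pv) c.
by case=> [|/contains_shift]; [left|right].
Qed.

(** No occurrence straddles the two parts. Hence the shortest prefix containing [sg] can be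
    recognized from [A] and [r] separately. *)
Lemma minimal_pjoin u v :
  is_partition v -> v <> [::] ->
  minimal (pjoin u v) <-> ~ contains u sg /\ minimal v.
Proof.
case/lastP: v => // v x pv _; move: (pv); rewrite is_partition_rcons => /andP [pv' _].
have e : pjoin u (rcons v x) = rcons (pjoin u v) (nblocks u + x).
  by rewrite /pjoin map_rcons rcons_cat.
split=> [[c m]|[nu [c m]]].
  have nuv := m _ _ e.
  have nu : ~ contains u sg.
    by move=> cu; apply: nuv; apply: contains_subseq cu; apply: prefix_subseq.
  split=> //; split; first by case: (contains_pjoin_split pv c).
  move=> v' y /rcons_inj [<- _] cv; apply: nuv.
  by apply: contains_subseq (suffix_subseq _ _) _; apply/contains_shift.
split.
  by apply: contains_subseq (suffix_subseq _ _) _; apply/contains_shift.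
rewrite e => u' y /rcons_inj [<- _] /(contains_pjoin_split pv') [//|].
exact: m (erefl _).
Qed.

Lemma first_prefix (Q : seq nat -> Prop) s :
  ~ Q [::] -> Q s -> exists P x Z, [/\ s = rcons P x ++ Z, Q (rcons P x) & ~ Q P].
Proof.
move=> Q0; elim/last_ind: s => [//|s x IH] Qs.
case: (classic (Q s)) => [/IH [P [y [Z [-> Qy nQ]]]]|nQ].
  by exists P, y, (rcons Z x); rewrite rcons_cat.
by exists s, x, [::]; rewrite cats0.
Qed.

Lemma classical_max (Q : nat -> Prop) m :
  (exists n, Q n) -> (forall n, Q n -> n <= m) ->
  exists2 n, Q n & forall k, Q k -> k <= n.
Proof.
elim: m => [|m IH] [n Qn] bd; first by exists n => // k /bd; case: k.
case: (classic (Q m.+1)) => [Qm|nQ]; first by exists m.+1.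
apply: IH; first by exists n.
by move=> k Qk; move: (bd _ Qk); rewrite leq_eqVlt => /orP [/eqP e|//]; case: nQ; rewrite -e.
Qed.

(* If [sg] is completed at or after the cut, with minimal letter [b], then by
   non-crossing every letter [> b] after it is new, hence [> a]. *)
Lemma avoid_after s P a Z rho :
  is_partition rho -> is_partition s -> ~ crossing s -> s = rcons P a ++ Z ->
  ~ contains P sg -> ~ contains (filter (ltn a) Z) rho -> ~ contains s (pjoin sg rho).
Proof.
move=> prho ps ncs es nP nZ [t [st /(order_iso_pjoin prho) [t1 [t2 [et i1 i2 lt]]]]].
have [b [nt1 hb lb _]] := sg_ends i1.
have bt1 : b \in t1 by rewrite -hb head_in.
move: st; rewrite et es cat_rcons => /(subseq_cat_last nt1) [s1|]; first by apply: nP; exists t1.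
rewrite lb => sb.
have sZ : subseq t2 Z.
  by move: sb => /=; case: eqP => // _; apply: subseq_trans; apply: subseq_cons.
apply: nZ; exists t2; split=> //; rewrite subseq_filter sZ andbT.
apply/allP => y yt2 /=; rewrite ltnNge; apply/negP => ya.
have by_ := lt _ _ bt1 yt2.
have sby : subseq [:: b; y] Z.
  have : subseq (b :: t2) Z by move: sb => /=; case: eqP => // ba; move: by_; lia.
  by apply: subseq_trans; rewrite /= eqxx sub1seq.
have pPa : is_partition (rcons P a) by move: ps; rewrite es; apply: is_partition_prefix.
have b0 : 0 < b.
  by apply: (partition_gt0 ps); rewrite es mem_cat (mem_subseq sby) ?orbT // mem_head.
have aP : a <= nblocks (rcons P a) by rewrite leq_nblocks // mem_rcons mem_head.
apply: ncs; exists b, y; split=> //; rewrite es.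
rewrite -[[:: b; y; b; y]]/([:: b; y] ++ [:: b; y]); apply: cat_subseq => //.
by apply: partition_subseq2 => //; [apply: partition_mem|]; lia.
Qed.

(** Otherwise the last letter [x] of [t1], and then [b], occur after this [a]. As [x < b <= a],
    restricted growth puts [x; b] into [rcons X a] too, which gives a crossing. *)
Lemma occurrence_before s X a W t1 t2 :
  is_partition s -> ~ crossing s -> s = X ++ a :: W -> subseq (t1 ++ t2) s ->
  (forall x y, x \in t1 -> y \in t2 -> x < y) -> t2 <> [::] -> head 0 t2 <= a ->
  subseq t1 X.
Proof.
move=> ps ncs es st lt nt2; set b := head 0 t2 => ba.
have bt2 : b \in t2 by apply: head_in.
case: t1 st lt => [|x1 t1] st lt; first exact: sub0seq.
move: st; rewrite es => /subseq_cat_last [//|//|].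
set x := last 0 _ => sx.
have xt1 : x \in x1 :: t1 by apply: last_in.
have xb := lt _ _ xt1 bt2.
have sW : subseq (x :: t2) W by move: sx => /=; case: eqP => // xa; move: xb; lia.
have sxb : subseq [:: x; b] W by apply: subseq_trans sW; rewrite /= eqxx sub1seq.
case: ncs; exists x, b; split=> //; rewrite es -cat_rcons.
rewrite -[[:: x; b; x; b]]/([:: x; b] ++ [:: x; b]); apply: cat_subseq => //.
have pXa : is_partition (rcons X a).
  by move: ps; rewrite es -cat_rcons; apply: is_partition_prefix.
have aP : a <= nblocks (rcons X a) by rewrite leq_nblocks // mem_rcons mem_head.
have x0 : 0 < x.
  apply: (partition_gt0 ps); rewrite es mem_cat in_cons (mem_subseq sW) ?orbT //.
  exact: mem_head.
by apply: partition_subseq2 => //; [apply: partition_mem|]; lia.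
Qed.

(** An occurrence with least letter above [a] survives deleting all letters up to [a]. What remains
    lies in [Y] and the shifted [z], separated by [k], so [split_ends] applies. *)
Lemma occurrence_head_le X Y a Z z k t :
  (forall x, x \in X -> x <= a) -> (forall y, y \in Y -> y <= k) ->
  is_partition z -> filter (ltn a) Z = map (addn k) z ->
  ~ contains Y sg -> ~ contains z sg ->
  order_iso t sg -> subseq t (X ++ rcons Y a ++ Z) -> head 0 t <= a.
Proof.
move=> Xa Yk pz eZ nY nz it st; rewrite leqNgt; apply/negP => ha.
have [b [_ hb _ bt]] := sg_ends it.
have : subseq t (filter (ltn a) (X ++ rcons Y a ++ Z)).
  rewrite subseq_filter st andbT; apply: sub_all bt => x /=.
  by move: ha; rewrite hb; apply: leq_trans.
rewrite -cats1 !filter_cat eZ /= ltnn cats0.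
have -> : filter (ltn a) X = [::].
  by apply/eqP; rewrite -[_ == _]negbK -has_filter; apply/negP => /hasP [x /Xa] /=; lia.
rewrite /= => st'; have : contains (filter (ltn a) Y ++ map (addn k) z) sg by exists t.
move=> /(@split_ends _ _ k) [||cY|/contains_shift//].
- by move=> x; rewrite mem_filter => /andP [_ /Yk].
- by move=> x /mapP [y /(partition_gt0 pz) y0 ->]; rewrite -[ltnLHS]addn0 ltn_add2l.
- by apply: nY; apply: contains_subseq cY; apply: filter_subseq.
Qed.

End Pattern.

(** * The two canonical splittings and the swap *)

Section Decomposition.

Variable sg : seq nat.
Hypothesis sg_ends : forall t, order_iso t sg -> ends_min t.

Lemma decode_last1 r :
  level_word r -> last 0 r = 1 ->
  exists y, decode r = rcons y 1 /\ exists y2, decode r = 1 :: y2.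
Proof.
move=> lr r1; have [_ ld] := last_dec lr r1; have pr := inv_part (decode_invP lr).
have nz : 0 < size (decode r) by rewrite size_dec; case: (r) r1.
case/lastP: (decode r) nz ld pr => // y x _; rewrite last_rcons => -> pr.
exists y; split=> //; case: y pr => [|x2 y] /andP [x2P _]; first by exists [::].
by exists (rcons y 1); rewrite rcons_cons; congr (_ :: _); lia.
Qed.

Lemma decode_neq0 r : last 0 r = 1 -> decode r <> [::].
Proof. by move=> r1 /decode_nil e; rewrite e in r1. Qed.

Lemma wf_pjoin_inj A1 r1 B1 M1 A2 r2 B2 M2 :
  wf_split A1 r1 B1 M1 -> wf_split A2 r2 B2 M2 ->
  decode (compose A1 r1 B1 M1) = decode (compose A2 r2 B2 M2) ->
  size (pjoin (decode A1) (decode r1)) = size (pjoin (decode A2) (decode r2)) ->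
  [/\ A1 = A2, r1 = r2, B1 = B2 & M1 = M2].
Proof.
move=> w1 w2 /(decode_inj (level_word_compose w1) (level_word_compose w2)) e.
rewrite !size_cat !size_map !size_dec; exact: compose_inj e.
Qed.

Definition left_split A r B M :=
  [/\ wf_split A r B M, ~ contains (decode A) sg & minimal sg (decode r)].
Definition right_split A r B M :=
  [/\ wf_split A r B M, ~ contains (decode B) sg & minimal sg (decode r)].

(** The decoded [A] and [r] join to the shortest prefix containing [sg], which the word
    determines. *)
Lemma left_split_inj A1 r1 B1 M1 A2 r2 B2 M2 :
  left_split A1 r1 B1 M1 -> left_split A2 r2 B2 M2 ->
  decode (compose A1 r1 B1 M1) = decode (compose A2 r2 B2 M2) ->
  [/\ A1 = A2, r1 = r2, B1 = B2 & M1 = M2].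
Proof.
move=> [w1 nA1 m1] [w2 nA2 m2] e; apply: wf_pjoin_inj => //.
have [Z1 e1 _] := decode_compose w1; have [Z2 e2 _] := decode_compose w2.
apply: (minimal_size (sg := sg) (z1 := Z1) (z2 := Z2)); last by rewrite -e1 -e2.
  by apply/(minimal_pjoin sg_ends _ (inv_part (decode_invP (wfr w1))) (decode_neq0 (wf1 w1))).
by apply/(minimal_pjoin sg_ends _ (inv_part (decode_invP (wfr w2))) (decode_neq0 (wf1 w2))).
Qed.

(** An occurrence of [sg] within [A] and [r] lies entirely below the copy of [B]. The other
    direction is [avoid_after], cut at the last letter of [r]. *)
Lemma contains_left A r B M rho :
  left_split A r B M -> is_partition rho ->
  contains (decode (compose A r B M)) (pjoin sg rho) <-> contains (decode B) rho.
Proof.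
move=> [w nA m] prho; have [Z e eZ] := decode_compose w.
have lw := level_word_compose w; have ps := inv_part (decode_invP lw).
have pr := inv_part (decode_invP (wfr w)); have pB := inv_part (decode_invP (wfB w)).
set N := nblocks (decode A) + nblocks (decode r) in eZ.
have mP := iffRL (minimal_pjoin sg_ends _ pr (decode_neq0 (wf1 w))) (conj nA m).
split=> [c|[t2 [s2 i2]]].
  have [y [ey _]] := decode_last1 (wfr w) (wf1 w).
  have eP : pjoin (decode A) (decode r) = rcons (pjoin (decode A) y) (nblocks (decode A)).+1.
    by rewrite {1}/pjoin ey map_rcons rcons_cat addn1.
  apply: NNPP => nB; move: c; apply: (avoid_after sg_ends prho ps (decode_noncrossing lw)).
  - by rewrite e eP.
  - by case: mP => _; apply; exact: eP.
  - by rewrite eZ => /contains_shift.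
have [t1 [s1 i1]] := mP.1; exists (t1 ++ map (addn N) t2); split.
  rewrite e; apply: cat_subseq => //.
  by apply: subseq_trans (filter_subseq (ltn (nblocks (decode A)).+1) Z); rewrite eZ map_subseq.
apply: pjoin_order_iso => //; first by rewrite order_iso_shift.
move=> x y /(mem_subseq s1) /leq_nblocks; rewrite nblocks_pjoin -/N => xN.
by move=> /mapP [z /(mem_subseq s2) /(partition_gt0 pB) z0 ->]; lia.
Qed.

Lemma right_head_le A r B M t :
  right_split A r B M -> order_iso t sg -> subseq t (decode (compose A r B M)) ->
  head 0 t <= (nblocks (decode A)).+1.
Proof.
move=> [w nB m] it; have [Z -> eZ] := decode_compose w.
have pB := inv_part (decode_invP (wfB w)).
have [y [ey _]] := decode_last1 (wfr w) (wf1 w).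
rewrite {1}/pjoin ey map_rcons addn1 -catA.
apply: (occurrence_head_le sg_ends _ _ pB eZ) => //.
- by move=> x /leq_nblocks; apply: leqW.
- move=> x /mapP [z zy ->]; rewrite leq_add2l; apply: leq_nblocks.
  by rewrite ey mem_rcons in_cons zy orbT.
- by move/contains_shift; case: m => _; apply; exact: ey.
Qed.

(** Together with [right_head_le], this makes [(nblocks (decode A)).+1] the largest least letter of
    an occurrence of [sg], so the word determines it. *)
Lemma right_occurrence A r B M :
  right_split A r B M ->
  exists t, [/\ order_iso t sg, subseq t (decode (compose A r B M))
              & nblocks (decode A) < head 0 t].
Proof.
move=> [w nB [[t [st it]] _]]; have [Z -> eZ] := decode_compose w.
exists (map (addn (nblocks (decode A))) t); split; first by rewrite order_iso_shift.
  by apply: subseq_trans (prefix_subseq _ _); apply: subseq_trans (suffix_subseq _ _);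
    apply: map_subseq.
have [b [nt _ _ _]] := sg_ends it; case: t nt st {it} => // x t _ st /=.
have : 0 < x.
  apply: (partition_gt0 (inv_part (decode_invP (wfr w)))).
  by apply: (mem_subseq st); rewrite mem_head.
by lia.
Qed.

Lemma compose_cons A r B M :
  wf_split A r B M -> exists W, decode (compose A r B M) = decode A ++ (nblocks (decode A)).+1 :: W.
Proof.
move=> w; have [Z -> _] := decode_compose w.
have [_ [_ [y2 ->]]] := decode_last1 (wfr w) (wf1 w).
by rewrite /pjoin /= addn1 -catA cat_cons; eexists.
Qed.

Lemma right_split_inj A1 r1 B1 M1 A2 r2 B2 M2 :
  right_split A1 r1 B1 M1 -> right_split A2 r2 B2 M2 ->
  decode (compose A1 r1 B1 M1) = decode (compose A2 r2 B2 M2) ->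
  [/\ A1 = A2, r1 = r2, B1 = B2 & M1 = M2].
Proof.
move=> d1 d2 e; have [w1 _ m1] := d1; have [w2 _ m2] := d2.
have eN : nblocks (decode A1) = nblocks (decode A2).
  have [t1 [i1 s1 h1]] := right_occurrence d1; have [t2 [i2 s2 h2]] := right_occurrence d2.
  rewrite e in s1; rewrite -e in s2.
  by have := right_head_le d1 i2 s2; have := right_head_le d2 i1 s1; lia.
apply: wf_pjoin_inj => //; rewrite !size_cat.
have notin (A : seq nat) : (nblocks (decode A)).+1 \notin decode A.
  by apply/negP => /leq_nblocks; rewrite ltnn.
(* The first letter of the copy of [r] does not occur in [A], so its index is the length of [A]. *)
have eA : size (decode A1) = size (decode A2).
  have [W1 e1] := compose_cons w1; have [W2 e2] := compose_cons w2.
  have := congr1 (index (nblocks (decode A1)).+1) e.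
  by rewrite e1 e2 !index_cat {3 5}eN !(negbTE (notin _)) /= eN !eqxx !addn0.
have [Z1 e1 _] := decode_compose w1; have [Z2 e2 _] := decode_compose w2.
move: e; rewrite e1 e2 /pjoin -!catA => /eqP; rewrite eqseq_cat // => /andP [_ /eqP].
(* Truncated subtraction undoes the shift on both copies of [r]; it may distort the tails, but
   [minimal_size] allows arbitrary ones. *)
rewrite eN !size_map => /(congr1 (map (subn^~ (nblocks (decode A2))))).
have idm (u : seq nat) :
    map (subn^~ (nblocks (decode A2))) (map (addn (nblocks (decode A2))) u) = u.
  by rewrite -map_comp map_id_in // => x _ /=; rewrite addKn.
by rewrite !map_cat !idm eA => /(minimal_size m1 m2) ->.
Qed.

(** [right_head_le] bounds the first letter of the copy of [sg], so [occurrence_before] pushes the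
    copy of [rho] into [A]. *)
Lemma contains_right A r B M rho :
  right_split A r B M -> is_partition sg ->
  contains (decode (compose A r B M)) (pjoin rho sg) <-> contains (decode A) rho.
Proof.
move=> d psg; have [w _ _] := d; have lw := level_word_compose w.
split=> [[t [st /(order_iso_pjoin psg) [t1 [t2 [et i1 i2 lt]]]]]|[t1 [s1 i1]]].
  exists t1; split=> //; have [W eW] := compose_cons w.
  rewrite et in st; have [b [nt2 _ _ _]] := sg_ends i2.
  apply: (occurrence_before (inv_part (decode_invP lw)) (decode_noncrossing lw) eW st lt nt2).
  by apply: (right_head_le d i2); apply: subseq_trans st; apply: suffix_subseq.
case: d => _ _ [[t2 [s2 i2]] _]; have [Z e _] := decode_compose w.
exists (t1 ++ map (addn (nblocks (decode A))) t2); split.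
  rewrite e /pjoin -catA; apply: cat_subseq => //.
  by apply: subseq_trans (prefix_subseq _ _); apply: map_subseq.
apply: pjoin_order_iso => //; first by rewrite order_iso_shift.
move=> x y /(mem_subseq s1) /leq_nblocks xN.
move=> /mapP [z /(mem_subseq s2) /(partition_gt0 (inv_part (decode_invP (wfr w)))) z0 ->].
by lia.
Qed.

Lemma not_contains_nil : ~ contains [::] sg.
Proof.
by move=> [t [st /sg_ends [b [nt _ _ _]]]]; apply: nt; move: st; case: t.
Qed.

Lemma compose_cut_decode w P x Z :
  level_word w -> decode w = rcons P x ++ Z ->
  exists A r B M,
    [/\ wf_split A r B M, w = compose A r B M & pjoin (decode A) (decode r) = rcons P x].
Proof.
move=> lw e; have qw : size P < size w.
    by rewrite -(size_dec w) e size_cat size_rcons leq_addr.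
have [A [r [B [M [wfD ew sz]]]]] := compose_cut lw qw; exists A, r, B, M; split=> //.
move: e; have [Z' e' _] := decode_compose wfD; rewrite ew e' => /eqP.
rewrite eqseq_cat => [/andP [/eqP //]|].
by rewrite size_cat size_map !size_dec sz size_rcons.
Qed.

Lemma left_split_exists w :
  level_word w -> contains (decode w) sg ->
  exists A r B M, left_split A r B M /\ w = compose A r B M.
Proof.
move=> lw c; have [P [x [Z [e c' nc]]]] :=
  first_prefix (Q := fun s => contains s sg) not_contains_nil c.
have [A [r [B [M [wfD ew eP]]]]] := compose_cut_decode lw e; exists A, r, B, M; split=> //.
have pr := inv_part (decode_invP (wfr wfD)).
have [|nA m] := iffLR (minimal_pjoin sg_ends (decode A) pr (decode_neq0 (wf1 wfD))).
  by rewrite eP; split=> // u y /rcons_inj [<- _].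
by split.
Qed.

(* Take the largest minimal letter [a] of an occurrence of [sg], and then the
   earliest position at which an occurrence with minimal letter [a] ends. *)
Lemma right_split_exists w :
  level_word w -> contains (decode w) sg ->
  exists A r B M, right_split A r B M /\ w = compose A r B M.
Proof.
move=> lw [t0 [st0 it0]].
pose occ a s := exists t, [/\ subseq t s, order_iso t sg & head 0 t = a].
have [||a oa maxa] := @classical_max (fun a => occ a (decode w)) (nblocks (decode w)).
- by exists (head 0 t0), t0.
- move=> n [t [st it <-]]; have [b [nt _ _ _]] := sg_ends it.
  by apply: leq_nblocks; apply: (mem_subseq st); apply: head_in.
have occ0 : ~ occ a [::].
  by move=> [t [st it _]]; apply: not_contains_nil; exists t.
have [P [x [Z [e [t [st it ht]] nP]]]] := first_prefix (Q := occ a) occ0 oa.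
have [b [nt hb lb allt]] := sg_ends it.
have lt : last 0 t = a by rewrite lb -hb.
have xa : x = a.
  case/subseq_rconsP: (st) => [s|[t' et _]]; first by case: nP; exists t.
  by rewrite -lt et last_rcons.
subst x; have [A [r [B [M [wfD ew eP]]]]] := compose_cut_decode lw e.
exists A, r, B, M; split=> //.
have [Z' e' eZ'] := decode_compose wfD.
have pr := inv_part (decode_invP (wfr wfD)); have pB := inv_part (decode_invP (wfB wfD)).
have [y [ey _]] := decode_last1 (wfr wfD) (wf1 wfD).
have [eP' ea] : P = pjoin (decode A) y /\ a = (nblocks (decode A)).+1.
  by move: eP; rewrite /pjoin ey map_rcons -rcons_cat addn1 => /rcons_inj [-> ->].
(* Letters of a partition are positive, so an occurrence shifted by [k >= a - 1] has least letter at
   least [a], and exactly [a] by maximality. *)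
have shifted u k t1 : is_partition u -> subseq t1 u -> order_iso t1 sg ->
    a <= k.+1 -> subseq (map (addn k) t1) (decode w) ->
    head 0 (map (addn k) t1) = a /\ k < a.
  move=> pu s1 i1 ak sw; have [_ [nt1 _ _ _]] := sg_ends i1.
  have hle : head 0 (map (addn k) t1) <= a.
    by apply: maxa; exists (map (addn k) t1); split=> //; rewrite order_iso_shift.
  case: t1 nt1 s1 hle {i1 sw} => // z t1 _ s1 /= hle.
  have z0 : 0 < z by apply: (partition_gt0 pu); apply: (mem_subseq s1); rewrite mem_head.
  lia.
have subA (v : seq nat) : subseq (map (addn (nblocks (decode A))) v) (pjoin (decode A) v).
  exact: suffix_subseq.
have subPw : subseq P (decode w).
  by rewrite e; apply: subseq_trans (prefix_subseq _ _); apply: subseq_rcons.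
split=> //.
  move=> [t1 [s1 i1]].
  have [||_] := shifted (decode B) (nblocks (decode A) + nblocks (decode r)) t1 pB s1 i1.
  - by rewrite ea; lia.
  - rewrite ew e'; apply: subseq_trans (suffix_subseq _ _).
    apply: subseq_trans (filter_subseq (ltn (nblocks (decode A)).+1) Z').
    by rewrite eZ'; apply: map_subseq.
  by rewrite ea ey nblocks_rcons; lia.
split.
  move: st; rewrite -eP => /subseq_catE [u [v [et su sv]]].
  case: u et su => [|c u] et su; last first.
    have /leq_nblocks : c \in decode A by apply: (mem_subseq su); rewrite mem_head.
    by move: ht; rewrite et /= => ->; rewrite ea ltnn.
  by apply/(contains_shift (nblocks (decode A))); exists t; split=> //; rewrite et.
move=> y' z /esym; rewrite ey => /rcons_inj [-> _] [t1 [s1 i1]].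
have sP : subseq (map (addn (nblocks (decode A))) t1) P.
  by rewrite eP'; apply: subseq_trans (subA y); apply: map_subseq.
have [|||h1 _] := shifted y (nblocks (decode A)) t1 _ s1 i1.
- by move: pr; rewrite ey is_partition_rcons => /andP [].
- by rewrite ea.
- exact: subseq_trans sP subPw.
by apply: nP; exists (map (addn (nblocks (decode A))) t1); rewrite order_iso_shift.
Qed.

End Decomposition.

(** * The bijection and its statistics *)

Lemma rel_bijection (T U : Type) (R : T -> U -> Prop) :
  (forall x, exists y, R x y) -> (forall y, exists x, R x y) ->
  (forall x y1 y2, R x y1 -> R x y2 -> y1 = y2) ->
  (forall x1 x2 y, R x1 y -> R x2 y -> x1 = x2) ->
  exists f : T -> U, bijective f /\ forall x, R x (f x).
Proof.
move=> totl totr func inj.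
pose f x := proj1_sig (constructive_indefinite_description _ (totl x)).
pose g y := proj1_sig (constructive_indefinite_description _ (totr y)).
have Rf x : R x (f x) := proj2_sig (constructive_indefinite_description _ (totl x)).
have Rg y : R (g y) y := proj2_sig (constructive_indefinite_description _ (totr y)).
exists f; split=> //; exists g => [x|y]; first exact: inj (Rg _) (Rf _).
exact: func (Rf _) (Rg _).
Qed.

Lemma NCAv_eq tau (x y : NCAv tau) : proj1_sig x = proj1_sig y -> x = y.
Proof.
case: x y => [s ps] [s' ps'] /= e; subst s'; congr exist; exact: proof_irrelevance.
Qed.

Lemma NCAv_mk tau s :
  is_partition s -> noncrossing s -> ~ contains s tau ->
  exists x : NCAv tau, proj1_sig x = s.
Proof. by move=> ps nc av; exists (exist _ s (conj ps (conj nc av))). Qed.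

Section Swap.

Variable sg : seq nat.

(** A relation rather than a function, since containment is a proposition and splittings come from
    existence lemmas; [rel_bijection] turns it into a map. *)
Definition swap_rel (s s' : seq nat) : Prop :=
  (~ contains s sg /\ s' = s) \/
  exists A r B M, [/\ left_split sg A r B M, s = decode (compose A r B M)
    & s' = decode (compose B r A (flip (last 0 A) (last 0 B) M))].

Lemma left_split_flip A r B M :
  left_split sg A r B M -> right_split sg B r A (flip (last 0 A) (last 0 B) M).
Proof. by case=> wfD nA m; split=> //; apply: wf_flip. Qed.

Lemma right_split_flip A r B M :
  right_split sg A r B M -> left_split sg B r A (flip (last 0 A) (last 0 B) M).
Proof. by case=> wfD nA m; split=> //; apply: wf_flip. Qed.

Lemma compose_contains A r B M :
  wf_split A r B M -> minimal sg (decode r) -> contains (decode (compose A r B M)) sg.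
Proof.
move=> wfD [c _]; have [Z -> _] := decode_compose wfD.
apply: contains_subseq (prefix_subseq _ _) _; apply: contains_subseq (suffix_subseq _ _) _.
exact/contains_shift.
Qed.

Lemma left_contains A r B M :
  left_split sg A r B M -> contains (decode (compose A r B M)) sg.
Proof. by case=> wfD _; apply: compose_contains. Qed.

Lemma right_contains A r B M :
  right_split sg A r B M -> contains (decode (compose A r B M)) sg.
Proof. by case=> wfD _; apply: compose_contains. Qed.

Lemma swap_rel_stat s s' :
  is_partition s -> noncrossing s -> swap_rel s s' ->
  size s' = size s /\ forall m, has_ncomp s m <-> has_ncomp s' m.
Proof.
move=> ps ncs [[_ ->]|[A [r [B [M [[wfD _ _] -> ->]]]]]]; first by [].
rewrite !size_dec size_compose_flip //; split=> // m.
have l1 := level_word_compose wfD; have l2 := level_word_compose (wf_flip wfD).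
by rewrite (has_ncomp_dec m l1) (has_ncomp_dec m l2) last_compose_flip.
Qed.

End Swap.

Theorem theorem3p3 (sigma rho : seq nat) :
  is_partition sigma -> noncrossing sigma ->
  is_partition rho -> noncrossing rho ->
  connected sigma ->
  cc_equiv (pjoin sigma rho) (pjoin rho sigma).
Proof.
move=> ps ncs prho _ cs.
have ends t (it : order_iso t sigma) := connected_ends cs ncs it.
have [||||f [bf Rf]] := @rel_bijection (NCAv (pjoin sigma rho)) (NCAv (pjoin rho sigma))
  (fun x y => swap_rel sigma (proj1_sig x) (proj1_sig y)).
- move=> [s [ps1 [nc1 av]]] /=; case: (classic (contains s sigma)) => cts; last first.
    have av' : ~ contains s (pjoin rho sigma) by move/(contains_pjoinr ps).
    by have [x ex] := NCAv_mk ps1 nc1 av'; exists x; rewrite ex; left.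
  have [w lw ew] := decode_surj ps1 nc1; subst s.
  have [A [r [B [M [d ew]]]]] := left_split_exists ends lw cts; subst w.
  have d' := left_split_flip d; have [wf' _ _] := d'; have lw' := level_word_compose wf'.
  have av' : ~ contains (decode (compose B r A (flip (last 0 A) (last 0 B) M))) (pjoin rho sigma).
    (* Both containments are equivalent to [B] containing [rho]. *)
    by move/(contains_right ends _ d' ps)/(contains_left ends d prho).
  have [x ex] := NCAv_mk (inv_part (decode_invP lw'))
    (iffRL (noncrossingP _) (decode_noncrossing lw')) av'.
  exists x; rewrite ex.
  by right; exists A, r, B, M.
- move=> [s [ps1 [nc1 av]]] /=; case: (classic (contains s sigma)) => cts; last first.
    have av' : ~ contains s (pjoin sigma rho) by move/(contains_pjoinl prho).
    by have [x ex] := NCAv_mk ps1 nc1 av'; exists x; rewrite ex; left.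
  have [w lw ew] := decode_surj ps1 nc1; subst s.
  have [A [r [B [M [d ew]]]]] := right_split_exists ends lw cts; subst w.
  have d' := right_split_flip d; have [wf' _ _] := d'; have lw' := level_word_compose wf'.
  have av' : ~ contains (decode (compose B r A (flip (last 0 A) (last 0 B) M))) (pjoin sigma rho).
    by move/(contains_left ends d' prho)/(contains_right ends _ d ps).
  have [x ex] := NCAv_mk (inv_part (decode_invP lw'))
    (iffRL (noncrossingP _) (decode_noncrossing lw')) av'.
  exists x; rewrite ex.
  right; exists B, r, A, (flip (last 0 A) (last 0 B) M); split=> //=.
  by case: d => wfD _ _; rewrite (flipK (leqnn _) (wfM wfD)).
(* Containing [sigma] decides which clause applies, and the left splitting is unique. *)
- move=> x y1 y2 H1 H2; apply: NCAv_eq; case: H1 H2.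
    move=> [nx ->] [[_ ->]//|[A [r [B [M [/left_contains + e _]]]]]].
    by rewrite -e.
  move=> [A [r [B [M [d e ->]]]]] [[nx _]|[A' [r' [B' [M' [d' e' ->]]]]]].
    by case: nx; rewrite e; apply: left_contains.
  have [] := left_split_inj ends d d'; first by rewrite -e.
  by move=> -> -> -> ->.
(* The image contains [sigma] exactly in the second clause; its unique right splitting then gives
   back the components and, after a second transposition, [M]. *)
- move=> x1 x2 y H1 H2; apply: NCAv_eq; case: H1 H2.
    move=> [nx ->] [[_ <-]//|[A [r [B [M [/left_split_flip /right_contains + _ e]]]]]].
    by rewrite -e.
  move=> [A [r [B [M [d -> e]]]]] [[nx e']|[A' [r' [B' [M' [d' -> e']]]]]].
    by case: nx; rewrite -e' e; apply: right_contains (left_split_flip d).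
  have := e; rewrite e' => /(right_split_inj ends (left_split_flip d') (left_split_flip d)).
  move=> [eB er eA eM]; subst A' r' B'; congr (decode (compose _ _ _ _)).
  case: d d' eM => wd _ _ [wd' _ _] /(congr1 (flip (last 0 B) (last 0 A))).
  by rewrite (flipK (leqnn _) (wfM wd)) (flipK (leqnn _) (wfM wd')).
exists f; split=> // x; have [px [ncx _]] := proj2_sig x.
exact: swap_rel_stat px ncx (Rf x).
Qed.
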